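(* Let $\varphi=\frac{1+\sqrt5}{2}$ and let $f$ be the entire function extending the local inverse $g^{-1}$ (with $f(0)=\varphi$) of $$g(w)=\lim_{n\to\infty}(2\varphi)^n\Bigl(\underbrace{\sqrt{1+\sqrt{1+\cdots\sqrt{1+w}}}}_{n}-\varphi\Bigr).$$ Let $\Sigma$ be the set of all infinite sequences $(\sigma_n)_{n\ge1}$ with $\sigma_n\in\{+1,-1\}$ that converge to $+1$ (i.e. $\sigma_n=+1$ for all sufficiently large $n$). Then for all $z\in\mathbb{C}$, $$f(z)=1+\varphi^{-1}\prod_{(\sigma_n)\in\Sigma}\left(1+z\varphi\prod_{n=1}^{\infty}\frac{\varphi+\sigma_n\sqrt{1+\sigma_{n-1}\sqrt{1+\cdots+\sigma_1\sqrt{2}}}}{2\varphi}\right).$$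
   Context: In the definition of $g$, the expression with underbrace $n$ denotes the $n$-fold composition of the map $w\mapsto\sqrt{1+w}$ applied to $w$, where the branch of the square root is the one with $\sqrt{1+\varphi}=\varphi$, analytic in a neighborhood of $w=\varphi$. The function $g$ is analytic in a neighborhood of $w=\varphi$ with $g(\varphi)=0$ and $g'(\varphi)=1$, so it has an analytic local inverse $f$ near $z=0$ with $f(0)=\varphi$, $f'(0)=1$. This $f$ extends to an entire function, still denoted $f$, and it satisfies $f(2\varphi z)=f(z)^2-1$ for all $z\in\mathbb{C}$. In the product formula, for $(\sigma_n)\in\Sigma$ the nested radicals are $y_n=\sigma_n\sqrt{1+\sigma_{n-1}\sqrt{1+\cdots+\sigma_1\sqrt2}}$, i.e. $y_1=\sigma_1\sqrt2$ and $y_n=\sigma_n\sqrt{1+y_{n-1}}$ for $n\ge2$, with $\sqrt{\cdot}$ the principal branch of the complex square root; the inner factor is $\prod_{n=1}^\infty\frac{\varphi+y_n}{2\varphi}$. The outer product runs over the countable set $\Sigma$. *)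

(* Defs.v *)
From HB Require Import structures.
From mathcomp Require Import all_boot all_order all_algebra finmap.
From mathcomp Require Import all_classical all_reals all_analysis.
From mathcomp Require Import showcase.summability.
From mathcomp Require Import complex.

Set Implicit Arguments.
Unset Strict Implicit.
Unset Printing Implicit Defensive.

Import Order.TTheory GRing.Theory Num.Theory.
Import numFieldNormedType.Exports.

Local Open Scope classical_set_scope.
Local Open Scope ring_scope.

(* The usual topology of the complex plane: R[i]^o carries the metric of the
   modulus `|_|, and R[i] inherits it. *)
HB.instance Definition _ (R : rcfType) := PseudoPointedMetric.copy R[i] R[i]^o.
HB.instance Definition _ (R : rcfType) := NormedModule.copy R[i] R[i]^o.

Section Definitions.
Context {R : realType}.
Local Notation C := R[i].

Definition analytic_at (f : C -> C) (c : C) : Prop :=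
  exists a : nat -> C,
    \forall z \near c, [series a n * (z - c) ^+ n]_n @ \oo --> f z.

Definition entire (f : C -> C) : Prop := forall c, analytic_at f c.

(* f is a local inverse of g, defined near b and with value a there. *)
Definition local_inverse (g f : C -> C) (a b : C) : Prop :=
  [/\ f b = a,
      \forall z \near b, g (f z) = z &
      \forall w \near a, f (g w) = w].

Definition phi : C := real_complex R ((1 + Num.sqrt 5) / 2).

(* [sqrtc] is the principal square root (nonnegative real part, cut along the
   negative real axis); near phi it is the branch with sqrt (1 + phi) = phi. *)
Definition g (w : C) : C :=
  limn (fun n => (2 * phi) ^+ n * (iter n (fun x => sqrtc (1 + x)) w - phi)).

(* Sequences are indexed from 0: s n stands for sigma_(n+1). *)
Definition Sigma : set (nat -> C) :=
  [set s | (forall n, s n = 1 \/ s n = -1) /\ s @ \oo --> (1 : C)].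

(* radical s n stands for y_(n+1). *)
Fixpoint radical (s : nat -> C) (n : nat) : C :=
  s n * sqrtc (if n is m.+1 then 1 + radical s m else 2).

Definition radical_partial_prod (s : nat -> C) (N : nat) : C :=
  \prod_(n < N) ((phi + radical s n) / (2 * phi)).

Definition radical_prod (s : nat -> C) : C := limn (radical_partial_prod s).

(* Finite partial products of the unordered product over Sigma; its value is
   their limit along [totally], the finite subsets directed by inclusion. *)
Definition Sigma_partial_prod (z : C) (A : {fset Sigma}) : C :=
  \prod_(s <- A) (1 + z * phi * radical_prod (val s)).

End Definitions.

Arguments Sigma R : clear implicits.
Arguments phi R : clear implicits.

(* Main.v *)
Require Import Defs.
From HB Require Import structures.
From mathcomp Require Import all_boot all_order all_algebra finmap.
From mathcomp Require Import all_classical all_reals all_analysis.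
From mathcomp Require Import showcase.summability.
From mathcomp Require Import complex ring lra.

Set Implicit Arguments.
Unset Strict Implicit.
Unset Printing Implicit Defensive.

Import Order.TTheory GRing.Theory Num.Theory.
Import numFieldNormedType.Exports.

Local Open Scope classical_set_scope.
Local Open Scope ring_scope.

(** Write P(w) = w^2 - 1 and r(w) = sqrt(1 + w), with the principal root, so
    that P o r is the identity and phi is a fixed point of both.

    The root has nonnegative real part, hence r contracts distances to phi by
    the factor 1/phi on the whole plane, and g exists everywhere, with
    g(r(w)) = g(w) / (2 phi) and g'(phi) = 1.  For the inverse f this gives
    f(2 phi z) = f(z)^2 - 1 near 0 ([inverse_radical_step_near]), and then for
    all z by the identity theorem ([functional_equation]); moreover
    c_n = (2 phi)^n (f(z / (2 phi)^n) - phi) tends to z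
    ([inverse_rescaled_cvg]), which is f'(0) = 1.

    Iterating the functional equation, f(z) - 1 = P^n(f(z / (2 phi)^n)) - 1.
    The roots of P^n - 1 are the 2^n nested radicals y_n, one for each choice
    of n signs ([preimage_factorization]).  Dividing the factorization by its
    value at the fixed point phi, which is phi - 1 = 1/phi, gives
      phi (f(z) - 1) = prod_y (1 + (f(z / (2 phi)^n) - phi) / (phi - y_n)).
    Since (phi + y_k)(phi - y_k) = phi - y_(k-1), the partial product p_n of
    the factors (phi + y_k) / (2 phi) is exactly
    1 / ((2 phi)^n phi (phi - y_n)) ([radical_partial_prod_eq1]).  So each
    factor above is 1 + c_n phi p_n, the factor of the infinite product with
    c_n for z and p_n for its limit ([finite_product_formula]).

    Letting n tend to infinity is a dominated convergence argument.  All
    radicals have modulus at most phi, so |p_n| does not increase with n.  When the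
    last sign -1 is at position m, the radical y_m lies in the left half
    plane, so |phi - y_m| >= phi and |p_n| <= (2 phi)^-m for n >= m.  At most
    2^(m-1) sequences have their last -1 at position m, and 2 < 2 phi: these
    bounds are summable over Sigma ([weight_sum_le2], [weight_tail_sum]), and
    uniformly in n the product over all sequences is close to the product over
    a fixed finite set ([dominated_product_le]). *)
Import ComplexField.Normc.
Local Notation Re := (@complex.Re _).
Local Notation Im := (@complex.Im _).

(** * Convergence in the complex plane *)

Section ComplexAnalysis.
Context {R : realType}.
Local Notation C := R[i].

Implicit Types (x y z w a b l : C).

Lemma normc_real (r : R) : normc r%:C%C = `|r|.
Proof. by rewrite /= expr0n /= addr0 sqrtr_sqr. Qed.

Lemma normC_normc z : `|z| = (normc z)%:C%C. Proof. by []. Qed.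

Lemma normc_ge0 z : 0 <= normc z.
Proof. by case: z => a b /=; exact: sqrtr_ge0. Qed.

Lemma normc_eq0 z : (normc z == 0) = (z == 0).
Proof.
apply/eqP/eqP => [/eq0_normc //|->]; exact: normc0.
Qed.

Lemma normc_gt0 z : (0 < normc z) = (z != 0).
Proof. by rewrite lt_def normc_ge0 andbT normc_eq0. Qed.

Lemma normc1E : normc (1 : C) = 1.
Proof. exact: normc1. Qed.

Lemma normcXE z n : normc (z ^+ n) = normc z ^+ n.
Proof. by elim: n => [|n IH]; rewrite ?expr0 ?normc1E // !exprS normcM IH. Qed.

Lemma normc_prod (I : Type) (s : seq I) (P : pred I) (F : I -> C) :
  normc (\prod_(i <- s | P i) F i) = \prod_(i <- s | P i) normc (F i).
Proof. exact: (big_morph _ (@normcM R) normc1E). Qed.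

Lemma normc_sum (I : Type) (s : seq I) (P : pred I) (F : I -> C) :
  normc (\sum_(i <- s | P i) F i) <= \sum_(i <- s | P i) normc (F i).
Proof.
elim/big_ind2 : _ => // [|x a y b xa yb]; first by rewrite normc0.
exact: le_trans (le_normcD _ _) (lerD xa yb).
Qed.

Lemma normcB x y : normc (x - y) = normc (y - x).
Proof. by rewrite -normcN opprB. Qed.

Lemma Re_le_normc z : `|Re z| <= normc z.
Proof. by rewrite -lecR -normC_normc; exact: normc_ge_Re. Qed.

Lemma Im_le_normc z : `|Im z| <= normc z.
Proof.
case: z => a b /=; rewrite -sqrtr_sqr ler_wsqrtr //.
by rewrite lerDr sqr_ge0.
Qed.

Lemma normc_le_ReIm z : normc z <= `|Re z| + `|Im z|.
Proof.
case: z => a b /=; rewrite -(@ler_pXn2r _ 2) ?nnegrE ?sqrtr_ge0 ?addr_ge0//.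
rewrite sqr_sqrtr ?addr_ge0 ?sqr_ge0//.
rewrite sqrrD !real_normK ?num_real//.
have : 0 <= `|a| * `|b| by rewrite mulr_ge0.
lra.
Qed.

(** The norm of the complex plane takes its values in [R[i]], which is only
    partially ordered; the real-valued modulus makes every later estimate an
    inequality in an ordered field. *)
Lemma cvgC_ltP (T : Type) (F : set_system T) {FF : Filter F} (u : T -> C) l :
  (u @ F --> l) <-> forall e : R, 0 < e -> \forall n \near F, normc (u n - l) < e.
Proof.
have H := @cvgrPdist_lt R[i] R[i] T F FF u l.
split.
  move=> /H K e e0; have := K e%:C%C; rewrite ltcR => /(_ e0).
  by apply: filterS => n; rewrite normC_normc ltcR normcB.
move=> K; apply/H => e e0.
have eE : e = (Re e)%:C%C.
  by rewrite RRe_real// ger0_real// ltW.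
have : 0 < Re e by rewrite -ltcR -eE.
move/K; apply: filterS => n.
by rewrite eE normC_normc ltcR normcB.
Qed.

Lemma nearC_ltP c (P : C -> Prop) : (\forall z \near c, P z) <->
  exists2 e : R, 0 < e & forall z, normc (z - c) < e -> P z.
Proof.
have H := @nbhs_ballP R[i] R[i] c P.
split.
  move=> /H [e e0 K].
  have eE : e = (Re e)%:C%C by rewrite RRe_real// ger0_real// ltW.
  exists (Re e); first by rewrite -ltcR -eE.
  move=> z zc; apply: K.
  have : `|c - z| < e by rewrite eE normC_normc ltcR normcB.
  by [].
move=> [e e0 K]; apply/H; exists e%:C%C; first by rewrite /= ltcR.
move=> z zc; apply: K; rewrite normcB -ltcR -normC_normc; exact: zc.
Qed.

Lemma cvgC_lim (T : Type) (F : set_system T) {FF : ProperFilter F}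
  (u : T -> C) l : u @ F --> l -> lim (u @ F) = l.
Proof. by move=> ul; apply: (cvg_lim (@norm_hausdorff R[i] R[i]) ul). Qed.

Lemma cvgC_M (T : Type) (F : set_system T) {FF : Filter F} (u v : T -> C) a b :
  u @ F --> a -> v @ F --> b -> (fun n => u n * v n) @ F --> a * b.
Proof. by move=> ua vb; exact: (@cvgM R[i] T F FF u v a b ua vb). Qed.

Lemma cvgC_D (T : Type) (F : set_system T) {FF : Filter F} (u v : T -> C) a b :
  u @ F --> a -> v @ F --> b -> (fun n => u n + v n) @ F --> a + b.
Proof. by move=> ua vb; exact: (@cvgD R[i] R[i] T F FF u v a b ua vb). Qed.

Lemma cvgC_cst (T : Type) (F : set_system T) {FF : Filter F} a :
  (fun _ : T => a) @ F --> a.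
Proof. exact: (@cvg_cst R[i] a T F FF). Qed.

Lemma cvgC_unique (T : Type) (F : set_system T) {FF : ProperFilter F}
  (u : T -> C) a b : u @ F --> a -> u @ F --> b -> a = b.
Proof. by move=> /cvgC_lim <- /cvgC_lim <-. Qed.

Lemma cvgC_shift (u : nat -> C) l :
  u @ \oo --> l -> (fun n => u n.+1) @ \oo --> l.
Proof.
move=> /cvgC_ltP ul; apply/cvgC_ltP => e /ul [N _ uN].
by exists N => // n /= Nn; apply: uN; exact: leqW.
Qed.

Lemma cvgC_unshift m (u : nat -> C) l :
  (fun n => u (m + n)%N) @ \oo --> l -> u @ \oo --> l.
Proof.
move=> /cvgC_ltP ul; apply/cvgC_ltP => e /ul [N _ uN].
exists (m + N)%N => // n /= Nn.
have mn : (m <= n)%N by rewrite (leq_trans _ Nn)// leq_addr.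
by rewrite -(subnKC mn); apply: uN; rewrite /= leq_subRL.
Qed.

Lemma cvgC_prod (T : Type) (F : set_system T) {FF : Filter F} n
    (u : nat -> T -> C) (a : nat -> C) :
  (forall j, (j < n)%N -> u j @ F --> a j) ->
  (fun t => \prod_(j < n) u j t) @ F --> \prod_(j < n) a j.
Proof.
elim: n => [|n IH] ua.
  under [X in X @ F --> _]eq_fun do rewrite big_ord0.
  rewrite big_ord0; exact: cvgC_cst.
under [X in X @ F --> _]eq_fun do rewrite big_ord_recr.
rewrite big_ord_recr; apply: cvgC_M; last exact: ua.
by apply: IH => j jn; apply: ua; rewrite ltnS ltnW.
Qed.

Lemma cvgC_le (T : Type) (F : set_system T) {FF : ProperFilter F} (u : T -> C) l a
    (M : R) :
  u @ F --> l -> (\forall n \near F, normc (u n - a) <= M) -> normc (l - a) <= M.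
Proof.
move=> /cvgC_ltP ul uM; apply/ler_addgt0Pl => e e0.
have [n []] : exists n, normc (u n - l) < e /\ normc (u n - a) <= M.
  by apply: (@filter_ex _ F FF); apply: filterI => //; exact: ul.
rewrite normcB => h1 h2; have := le_normcD (l - u n) (u n - a).
by rewrite subrKA; lra.
Qed.

Lemma cvgr_geometric_increments (x : nat -> R) (K r : R) : 0 <= r < 1 ->
  (forall n, `|x n.+1 - x n| <= K * r ^+ n) -> cvgn x.
Proof.
move=> /andP[r0 r1] xK.
have -> : x = (fun n => x 0%N + series (telescope x) n).
  by apply/funext => n; rewrite -eq_sum_telescope.
apply: is_cvgD; first exact: is_cvg_cst.
apply: normed_cvg.
apply: (@series_le_cvg _ _ (geometric K r)) => //.
- by move=> n; rewrite normr_ge0.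
- by move=> n; exact: le_trans (normr_ge0 _) (xK n).
- by apply: is_cvg_geometric_series; rewrite ger0_norm.
Qed.

(** Completeness of the plane enters here only: the real and imaginary parts
    are sums of series dominated by a geometric one. *)
Lemma cvgC_geometric_increments (u : nat -> C) (K r : R) : 0 <= r < 1 ->
  (forall n, normc (u n.+1 - u n) <= K * r ^+ n) -> exists l, u @ \oo --> l.
Proof.
move=> r01 uK.
have /cvg_ex[a ua] : cvgn (fun n => Re (u n)).
  apply: (cvgr_geometric_increments r01 (K := K)) => n.
  apply: le_trans (uK n); apply: le_trans (Re_le_normc _).
  by case: (u n.+1) (u n) => a b [c d].
have /cvg_ex[b ub] : cvgn (fun n => Im (u n)).
  apply: (cvgr_geometric_increments r01 (K := K)) => n.
  apply: le_trans (uK n); apply: le_trans (Im_le_normc _).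
  by case: (u n.+1) (u n) => ? ? [c d].
exists (a +i* b)%C; apply/cvgC_ltP => e e0.
have e2 : 0 < e / 2 by rewrite divr_gt0.
move/cvgrPdist_lt : ua => /(_ _ e2) ua.
move/cvgrPdist_lt : ub => /(_ _ e2) ub.
near=> n.
have h1 : `|a - Re (u n)| < e / 2 by near: n.
have h2 : `|b - Im (u n)| < e / 2 by near: n.
apply: le_lt_trans (normc_le_ReIm _) _.
have -> : Re (u n - (a +i* b)%C) = Re (u n) - a by case: (u n).
have -> : Im (u n - (a +i* b)%C) = Im (u n) - b by case: (u n).
rewrite (distrC (Re _)) (distrC (Im _)); lra.
Unshelve. all: by end_near. Qed.

End ComplexAnalysis.

(** * Products of factors close to 1 *)

Section InfiniteProducts.
Context {R : realType}.
Local Notation C := R[i].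

Lemma prod1D_le_expR (I : Type) (s : seq I) (b : I -> R) : (forall i, 0 <= b i) ->
  \prod_(i <- s) (1 + b i) <= expR (\sum_(i <- s) b i).
Proof.
move=> b0; elim: s => [|i s IH]; first by rewrite !big_nil expR0.
rewrite !big_cons expRD; apply: ler_pM => //.
- by rewrite addr_ge0.
- by apply: prodr_ge0 => j _; rewrite addr_ge0.
- exact: expR_ge1Dx.
Qed.

(** Once both products are expanded, the constant term 1 cancels and every
    other monomial on the left is dominated by its counterpart. *)
Lemma normc_prod1D_sub1 (I : Type) (s : seq I) (x : I -> C) (b : I -> R) :
  (forall i, normc (x i) <= b i) ->
  normc (\prod_(i <- s) (1 + x i) - 1) <= \prod_(i <- s) (1 + b i) - 1.
Proof.
move=> xb; elim: s => [|i s IH]; first by rewrite !big_nil !subrr normc0.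
rewrite !big_cons; set p := \prod_(j <- s) (1 + x j) in IH *.
set q := \prod_(j <- s) (1 + b j) in IH *.
have -> : (1 + x i) * p - 1 = (p - 1) + x i * p by ring.
apply: le_trans (le_normcD _ _) _; rewrite normcM.
have pq : normc p <= q.
  have := le_normcD (p - 1) 1; rewrite subrK normc1E; lra.
have : normc (x i) * normc p <= b i * q by apply: ler_pM => //; exact: normc_ge0.
lra.
Qed.

Lemma expR_sub1_le (T : R) : expR T - 1 <= T * expR T.
Proof.
have := expR_ge1Dx (- T).
have e0 := expR_gt0 T.
rewrite expRN => h.
have : (1 - T) * expR T <= (expR T)^-1 * expR T by rewrite ler_pM2r.
rewrite mulVf ?gt_eqF//; lra.
Qed.

Lemma normc_prod1D_sub1_le (I : Type) (s : seq I) (x : I -> C) (b : I -> R) (T : R) :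
  (forall i, normc (x i) <= b i) -> \sum_(i <- s) b i <= T ->
  normc (\prod_(i <- s) (1 + x i) - 1) <= T * expR T.
Proof.
move=> xb sT; apply: le_trans (normc_prod1D_sub1 _ xb) _.
apply: le_trans _ (expR_sub1_le T); rewrite lerD2r.
apply: le_trans (prod1D_le_expR _ _) _; last by rewrite ler_expR.
by move=> i; exact: le_trans (normc_ge0 _) (xb i).
Qed.

Lemma normc_prod1D_le (I : Type) (s : seq I) (x : I -> C) (b : I -> R) (T : R) :
  (forall i, normc (x i) <= b i) -> \sum_(i <- s) b i <= T ->
  normc (\prod_(i <- s) (1 + x i)) <= expR T.
Proof.
move=> xb sT; have b0 i : 0 <= b i by exact: le_trans (normc_ge0 _) (xb i).
apply: le_trans (_ : expR (\sum_(i <- s) b i) <= _); last by rewrite ler_expR.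
apply: le_trans _ (prod1D_le_expR _ b0).
rewrite normc_prod; apply: ler_prod => i _; rewrite normc_ge0/=.
by apply: le_trans (le_normcD _ _) _; rewrite normc1E lerD2l.
Qed.

Lemma sum_geometric_le (K r : R) n : 0 <= K -> 0 <= r < 1 ->
  \sum_(k < n) K * r ^+ k <= K / (1 - r).
Proof.
move=> K0 /andP[r0 r1]; rewrite -mulr_sumr; apply: ler_wpM2l => //.
have d0 : 0 < 1 - r by lra.
rewrite -[leRHS]mul1r ler_pdivlMr//.
have := subrX1 r n; have : 0 <= r ^+ n by rewrite exprn_ge0.
set s := \sum_(i < n) _; nra.
Qed.

Lemma geometric_majorant_ge0 (u : nat -> C) (K r : R) :
  (forall k, normc (u k) <= K * r ^+ k) -> 0 <= K.
Proof.
move=> /(_ 0%N); rewrite expr0 mulr1; exact: le_trans (normc_ge0 _).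
Qed.

(** The partial products stay below exp (K / (1 - r)), so consecutive ones
    differ by a geometrically small amount.  The distance of the limit to 1 is
    of the order of [K]: applied with [K] equal to the distance of a point to
    phi, this yields the derivative of [g] at phi. *)
Lemma cvg_prod1D_geometric (u : nat -> C) (K r : R) : 0 <= r < 1 ->
  (forall k, normc (u k) <= K * r ^+ k) ->
  exists2 l : C, (fun n => \prod_(k < n) (1 + u k)) @ \oo --> l &
             normc (l - 1) <= K / (1 - r) * expR (K / (1 - r)).
Proof.
move=> r01 uK.
have K0 : 0 <= K := geometric_majorant_ge0 uK.
have sumK n : \sum_(k < n) K * r ^+ k <= K / (1 - r) by exact: sum_geometric_le.
have [l pl] : exists l : C, (fun n => \prod_(k < n) (1 + u k)) @ \oo --> l.
  apply: (@cvgC_geometric_increments _ _ (expR (K / (1 - r)) * K) r) => // n.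
  rewrite big_ord_recr /= mulrDr mulr1 addrC addKr normcM -mulrA.
  apply: ler_pM; rewrite ?normc_ge0//.
  exact: (normc_prod1D_le (fun k : 'I_n => uK k) (sumK n)).
exists l; first exact: pl.
apply: (cvgC_le pl); near=> n.
exact: (normc_prod1D_sub1_le (fun k : 'I_n => uK k) (sumK n)).
Unshelve. all: by end_near. Qed.

End InfiniteProducts.

(** * The contraction towards the golden ratio and its linearization *)

Section GoldenRatio.
Context {R : realType}.
Local Notation C := R[i].
Local Notation phi := (phi R).

Definition golden : R := (1 + Num.sqrt 5) / 2.

Lemma phiE : phi = golden%:C%C. Proof. by []. Qed.

Lemma golden_sqr : golden ^+ 2 = 1 + golden.
Proof.
have h5 : (Num.sqrt 5 : R) ^+ 2 = 5 by rewrite sqr_sqrtr.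
rewrite /golden; move: h5; set s := Num.sqrt 5; nra.
Qed.

Lemma golden_gt32 : 3 / 2 < golden :> R.
Proof.
have h5 : (Num.sqrt 5 : R) ^+ 2 = 5 by rewrite sqr_sqrtr.
have s0 : 0 <= Num.sqrt 5 :> R by exact: sqrtr_ge0.
rewrite /golden; move: h5 s0; set s := Num.sqrt 5; nra.
Qed.

Lemma golden_gt0 : 0 < golden :> R. Proof. have := golden_gt32; lra. Qed.

Lemma golden_ge0 : 0 <= golden :> R. Proof. exact: ltW golden_gt0. Qed.

Lemma phi_sqr : phi ^+ 2 = 1 + phi.
Proof. by rewrite phiE -rmorphXn golden_sqr rmorphD rmorph1. Qed.

Lemma phi_neq0 : phi != 0.
Proof. by rewrite -normc_gt0 phiE normc_real normr_gt0 gt_eqF// golden_gt0. Qed.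

Lemma twophi_neq0 : 2 * phi != 0.
Proof. by rewrite mulf_neq0 ?phi_neq0 ?pnatr_eq0. Qed.

Lemma normc_phi : normc phi = golden.
Proof. by rewrite phiE normc_real ger0_norm// ltW// golden_gt0. Qed.

Lemma normc_twophi : normc (2 * phi) = 2 * golden.
Proof.
have -> : 2 * phi = phi + phi by ring.
have g0 := golden_gt0.
by rewrite phiE -rmorphD normc_real ger0_norm; lra.
Qed.

Lemma inv_golden01 : 0 <= (golden : R)^-1 < 1.
Proof.
have := golden_gt32 => h.
by rewrite invr_ge0 ltW ?golden_gt0//= invf_lt1 ?golden_gt0//; lra.
Qed.

Definition radical_step (w : C) : C := sqrtc (1 + w).

Lemma Re_sqrtc_ge0 (z : C) : 0 <= Re (sqrtc z).
Proof. by case: z => a b /=; exact: sqrtr_ge0. Qed.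

Lemma radical_step_sqr w : radical_step w ^+ 2 = 1 + w. Proof. exact: sqr_sqrtc. Qed.

Lemma normc_phiD_ge (z : C) : 0 <= Re z -> golden <= normc (phi + z).
Proof.
move=> z0; apply: le_trans _ (Re_le_normc _); apply: le_trans _ (ler_norm _).
by case: z z0 => a b /= a0; rewrite lerDl.
Qed.

Lemma phiD_radical_step_neq0 w : phi + radical_step w != 0.
Proof.
rewrite -normc_gt0; apply: lt_le_trans golden_gt0 _.
exact: normc_phiD_ge (Re_sqrtc_ge0 _).
Qed.

Lemma radical_step_subphi w :
  (radical_step w - phi) * (phi + radical_step w) = w - phi.
Proof.
have -> : (radical_step w - phi) * (phi + radical_step w) =
  radical_step w ^+ 2 - phi ^+ 2 by ring.
by rewrite radical_step_sqr phi_sqr; ring.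
Qed.

(** The difference quotient at the fixed point phi is 1 / (phi + sqrt (1 + w)),
    and the principal root has nonnegative real part: the contraction is
    global, although the root is discontinuous along its cut. *)
Lemma normc_radical_step_subphi w :
  normc (radical_step w - phi) <= normc (w - phi) * golden^-1.
Proof.
rewrite -(radical_step_subphi w) normcM ler_pdivlMr ?golden_gt0//.
apply: ler_wpM2l; first exact: normc_ge0.
exact: normc_phiD_ge (Re_sqrtc_ge0 _).
Qed.

Lemma normc_iter_radical_step_subphi w n :
  normc (iter n radical_step w - phi) <= normc (w - phi) * golden^-1 ^+ n.
Proof.
elim: n => [|n IH]; first by rewrite expr0 mulr1.
rewrite iterS exprSr mulrA; apply: le_trans (normc_radical_step_subphi _) _.
by apply: ler_wpM2r IH; rewrite invr_ge0 ltW// golden_gt0.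
Qed.

(** Each step divides the difference to phi by phi plus the new iterate.  This
    divisor tends to 2 phi, which makes the scaling by powers of 2 phi a
    product of factors tending geometrically to 1. *)
Lemma scaled_iter_radical_stepE w n : (2 * phi) ^+ n * (iter n radical_step w - phi) =
  (w - phi) * \prod_(k < n)
    (1 + (phi - iter k.+1 radical_step w) / (phi + iter k.+1 radical_step w)).
Proof.
elim: n => [|n IH]; first by rewrite big_ord0 expr0 mul1r mulr1.
rewrite big_ord_recr /= mulrA -IH; set v := iter n radical_step w.
rewrite exprSr -(radical_step_subphi v).
have E (L p r : C) : p + r != 0 -> L * (2 * p) * (r - p) =
  L * ((r - p) * (p + r)) * (1 + (p - r) / (p + r)) by move=> pr; field.
exact: E (phiD_radical_step_neq0 v).
Qed.

Lemma scaled_iter_radical_step_cvg w : exists2 G : C,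
  (fun n => (2 * phi) ^+ n * (iter n radical_step w - phi)) @ \oo --> (w - phi) * G &
  normc (G - 1) <= normc (w - phi) / (1 - golden^-1) *
                   expR (normc (w - phi) / (1 - golden^-1)).
Proof.
have [|G cG G1] := @cvg_prod1D_geometric _
  (fun k => (phi - iter k.+1 radical_step w) / (phi + iter k.+1 radical_step w))
  (normc (w - phi)) _ inv_golden01.
  move=> k; rewrite normcM normcV normcB.
  rewrite ler_pdivrMr ?normc_gt0 ?phiD_radical_step_neq0//.
  apply: le_trans (normc_iter_radical_step_subphi _ _) _.
  rewrite exprSr mulrA; apply: ler_wpM2l.
    by rewrite mulr_ge0 ?normc_ge0 ?exprn_ge0// invr_ge0 ltW// golden_gt0.
  apply: le_trans _ (normc_phiD_ge (Re_sqrtc_ge0 _)).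
  by have := golden_gt32; have /andP[_ ] := inv_golden01; lra.
exists G; last exact: G1.
rewrite (_ : (fun n => _) = (fun n => (w - phi) *
  \prod_(k < n)
    (1 + (phi - iter k.+1 radical_step w) / (phi + iter k.+1 radical_step w)))).
  apply: cvgC_M cG; exact: cvgC_cst.
by apply/funext => n; exact: scaled_iter_radical_stepE.
Qed.

Lemma g_cvg w :
  (fun n => (2 * phi) ^+ n * (iter n radical_step w - phi)) @ \oo --> g w.
Proof.
have [G cG _] := scaled_iter_radical_step_cvg w.
by have := cvgC_lim cG; rewrite /g => ->.
Qed.

Lemma g_factor w : exists2 G : C, g w = (w - phi) * G &
  normc (G - 1) <= normc (w - phi) / (1 - golden^-1) *
                   expR (normc (w - phi) / (1 - golden^-1)).
Proof.
have [G cG G1] := scaled_iter_radical_step_cvg w; exists G; last exact: G1.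
exact: (cvgC_unique (@g_cvg w) cG).
Qed.

(** Schroeder's equation: [g] conjugates [radical_step] to the division by
    2 phi. *)
Lemma g_radical_step w : 2 * phi * g (radical_step w) = g w.
Proof.
have h : (fun n => (2 * phi) *
      ((2 * phi) ^+ n * (iter n radical_step (radical_step w) - phi))) @ \oo -->
    2 * phi * g (radical_step w).
  apply: cvgC_M (@g_cvg _); exact: cvgC_cst.
apply: (cvgC_unique h).
rewrite (_ : (fun n => _) = (fun n =>
    (2 * phi) ^+ n.+1 * (iter n.+1 radical_step w - phi))).
  exact: cvgC_shift (@g_cvg w).
by apply/funext => n; rewrite exprS iterSr mulrA.
Qed.

End GoldenRatio.

(** * Power series and the identity theorem *)

Section PowerSeries.
Context {R : realType}.
Local Notation C := R[i].
Implicit Types (f : C -> C) (c : C) (a : nat -> C) (r M : R).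

Lemma series_ordE (u : nat -> C) n : series u n = \sum_(k < n) u k.
Proof. by rewrite /series /= big_mkord. Qed.

Lemma sum_ordD_sub (u : nat -> C) m k :
  \sum_(j < m + k) u j - \sum_(j < m) u j = \sum_(j < k) u (m + j)%N.
Proof. by rewrite big_split_ord/= [X in X - _]addrC addrK. Qed.

Lemma eventually_le_bounded (x : nat -> R) (M : R) : (forall n, 0 <= x n) ->
  (\forall n \near \oo, x n <= M) -> exists B, forall n, x n <= B.
Proof.
move=> x0 [N _ xM]; exists (`|M| + \sum_(k < N) x k) => n.
have s0 m : 0 <= \sum_(k < m) x k by apply: sumr_ge0 => i _.
have [nN|Nn] := ltnP n N.
  rewrite (bigD1 (Ordinal nN)) //= addrCA lerDl addr_ge0 //.
  by apply: sumr_ge0 => i _.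
have := xM n Nn => /= h; have := ler_norm M; have := s0 N; lra.
Qed.

Lemma cvg_series_bounded_terms (u : nat -> C) (l : C) :
  series u @ \oo --> l -> exists M : R, forall n, normc (u n) <= M.
Proof.
move=> /cvgC_ltP /(_ 1 ltr01) [N _ uN].
apply: (@eventually_le_bounded _ 2); first by move=> n; exact: normc_ge0.
exists N => // n /= Nn.
have h1 := uN n Nn; have h2 := uN n.+1 (leqW Nn); rewrite /= in h1 h2.
have -> : u n = (series u n.+1 - l) + (l - series u n).
  by rewrite !series_ordE big_ord_recr /=; ring.
by apply: le_trans (le_normcD _ _) _; rewrite (normcB l); lra.
Qed.

(** The coefficient estimate is kept next to the expansion because all later
    arguments compare a power series with a geometric series. *)
Definition has_expansion (f : C -> C) (c : C) (a : nat -> C) (r M : R) :=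
  [/\ 0 < r, forall n, normc (a n) * r ^+ n <= M &
      forall z, normc (z - c) < r ->
        series (fun n => a n * (z - c) ^+ n) @ \oo --> f z].

Lemma expansion_bound_ge0 f c a r M : has_expansion f c a r M -> 0 <= M.
Proof.
case=> _ /(_ 0%N) + _; rewrite expr0 mulr1; exact: le_trans (normc_ge0 _).
Qed.

(** Halving the radius leaves a point of the circle at which the series
    converges, so that its terms are bounded there. *)
Lemma analytic_has_expansion f c : analytic_at f c ->
  exists a r M, has_expansion f c a r M.
Proof.
move=> [a /nearC_ltP [e e0 fa]].
have e2 : 0 < e / 2 by rewrite divr_gt0.
have d2 : normc (c + (e / 2)%:C%C - c) = e / 2.
  by rewrite addrC addKr normc_real ger0_norm// ltW.
have [|M aM] := @cvg_series_bounded_terms _ _ (fa (c + (e / 2)%:C%C) _).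
  by rewrite d2; lra.
exists a, (e / 2), M; split => //.
  by move=> n; have := aM n; rewrite normcM normcXE d2.
by move=> z ze; apply: fa; lra.
Qed.

Lemma expansion_term_le f c a r M z n : has_expansion f c a r M ->
  normc (a n * (z - c) ^+ n) <= M * (normc (z - c) / r) ^+ n.
Proof.
move=> [r0 aM _]; rewrite normcM normcXE expr_div_n mulrA.
rewrite ler_pdivlMr ?exprn_gt0// mulrAC.
by apply: ler_wpM2r; rewrite ?exprn_ge0 ?normc_ge0.
Qed.

Lemma normc_sum_tail_le (u : nat -> C) (M q : R) n m : 0 <= q < 1 ->
  (forall k, normc (u k) <= M * q ^+ k) ->
  normc (\sum_(k < m) u (n + k)%N) <= M * q ^+ n / (1 - q).
Proof.
move=> q01 uM; apply: le_trans (normc_sum _ _ _) _.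
have M0 : 0 <= M := geometric_majorant_ge0 uM.
have /andP[q0 _] := q01.
apply: le_trans (sum_geometric_le m _ q01); last by rewrite mulr_ge0 ?exprn_ge0.
by apply: ler_sum => k _; rewrite -mulrA -exprD; exact: uM.
Qed.

Lemma expansion_remainder_le n f c a r M z : has_expansion f c a r M ->
  normc (z - c) <= r / 2 ->
  normc (f z - \sum_(k < n) a k * (z - c) ^+ k) <= 2 * (M * (normc (z - c) / r) ^+ n).
Proof.
move=> H zr; have [r0 aM fa] := H.
have M0 : 0 <= M := expansion_bound_ge0 H.
have q2 : normc (z - c) / r <= 1 / 2 by rewrite ler_pdivrMr//; lra.
have q0 : 0 <= normc (z - c) / r by rewrite divr_ge0 ?normc_ge0 ?ltW.
have q01 : 0 <= normc (z - c) / r < 1 by rewrite q0/=; lra.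
have zr' : normc (z - c) < r by lra.
apply: (cvgC_le (fa z zr')); exists n => // m /= nm.
rewrite series_ordE -(subnKC nm) (sum_ordD_sub (fun k => a k * (z - c) ^+ k)).
have := normc_sum_tail_le n (m - n) q01 (fun k => expansion_term_le z k H).
move=> /le_trans; apply; rewrite ler_pdivrMr; last lra.
have : 0 <= M * (normc (z - c) / r) ^+ n by rewrite mulr_ge0 ?exprn_ge0.
nra.
Qed.

Lemma analytic_continuous f c (e : R) : analytic_at f c -> 0 < e ->
  exists2 d : R, 0 < d & forall z, normc (z - c) < d -> normc (f z - f c) < e.
Proof.
move=> /analytic_has_expansion [a [r [M H]]] e0; have [r0 aM _] := H.
have M0 : 0 <= M := expansion_bound_ge0 H.
have M1 : 0 < 2 * M + 1 by lra.
have fc : f c = a 0%N.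
  apply/eqP; rewrite -subr_eq0 -normc_eq0 eq_le normc_ge0 andbT.
  have := @expansion_remainder_le 1 _ _ _ _ _ c H _.
  rewrite big_ord1 expr0 mulr1 subrr normc0 mul0r expr1 !mulr0; apply; lra.
exists (Num.min (r / 2) (e * r / (2 * M + 1))).
  by rewrite lt_min !divr_gt0// mulr_gt0.
move=> z; rewrite lt_min => /andP[zr ze].
have := @expansion_remainder_le 1 _ _ _ _ _ z H (ltW zr).
rewrite big_ord1 expr0 mulr1 -fc expr1 => /le_lt_trans; apply.
rewrite !mulrA ltr_pdivrMr//; move: ze; rewrite ltr_pdivlMr//.
have := normc_ge0 (z - c); nra.
Qed.

Lemma analytic_sub (f1 f2 : C -> C) c : analytic_at f1 c -> analytic_at f2 c ->
  analytic_at (fun z => f1 z - f2 z) c.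
Proof.
move=> [a fa] [b fb]; exists (fun n => a n - b n); move: fa fb.
move=> /nearC_ltP [d d0 fa] /nearC_ltP [e e0 fb]; apply/nearC_ltP.
exists (Num.min d e); first by rewrite lt_min d0.
move=> z; rewrite lt_min => /andP[zd ze].
have h := cvgC_D (fa z zd) (cvgC_M (@cvgC_cst _ _ \oo _ (-1)) (fb z ze)).
rewrite mulN1r in h.
rewrite (_ : [series _]_n = (fun n => [series a k * (z - c) ^+ k]_k n +
  -1 * [series b k * (z - c) ^+ k]_k n)); first exact: h.
apply/funext => n; rewrite !series_ordE mulN1r -sumrB.
by apply: eq_bigr => i _ /=; rewrite mulrBl.
Qed.

Lemma analytic_cst (k c : C) : analytic_at (fun=> k) c.
Proof.
exists (fun n => if n is 0%N then k else 0); apply/nearC_ltP; exists 1 => // z _.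
apply/cvgC_ltP => e e0; exists 1%N => // -[//|n] _ /=.
rewrite series_ordE big_ord_recl expr0 mulr1 big1 ?addr0 ?subrr ?normc0// => i _.
by rewrite mul0r.
Qed.

Lemma analytic_scale f (l c : C) : analytic_at f (l * c) ->
  analytic_at (fun z => f (l * z)) c.
Proof.
move=> [a /nearC_ltP [e e0 fa]]; exists (fun n => a n * l ^+ n); apply/nearC_ltP.
exists (e / (normc l + 1)); first by rewrite divr_gt0// ltr_wpDl// normc_ge0.
move=> z; rewrite ltr_pdivlMr ?ltr_wpDl ?normc_ge0// => ze.
have -> : (fun n => a n * l ^+ n * (z - c) ^+ n) =
    (fun n => a n * (l * z - l * c) ^+ n).
  by apply/funext => n; rewrite -mulrBr exprMn mulrA.
apply: fa; rewrite -mulrBr normcM; have := normc_ge0 (z - c); nra.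
Qed.

Lemma cauchy_product_partial_sum (u v : nat -> C) N :
  \sum_(n < N) \sum_(i < n.+1) u i * v (n - i)%N =
  \sum_(i < N) u i * \sum_(j < N - i) v j.
Proof.
elim: N => [|N IH]; first by rewrite !big_ord0.
rewrite big_ord_recr IH /= [RHS]big_ord_recr/= subSnn big_ord1.
rewrite [in X in _ + X]big_ord_recr/= subnn addrA; congr (_ + _).
rewrite -big_split/=; apply: eq_bigr => i _.
by rewrite subSn ?(ltnW (ltn_ord i))// big_ord_recr/= mulrDr.
Qed.

(** Grouped by the index of [u], the error consists of [N] products of one term
    of [u] and one tail of [v], each of the order of M^2 q^N.  The factor [N] is
    absorbed by N <= 2^N, which is why [q] is taken at most 1/4. *)
Lemma cauchy_product_error_le (u v : nat -> C) (M q : R) N : 0 <= q <= 1 / 4 ->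
  (forall k, normc (u k) <= M * q ^+ k) -> (forall k, normc (v k) <= M * q ^+ k) ->
  normc ((\sum_(i < N) u i) * (\sum_(j < N) v j) -
    \sum_(n < N) \sum_(i < n.+1) u i * v (n - i)%N) <= 2 * M ^+ 2 * (1 / 2) ^+ N.
Proof.
move=> /andP[q0 q4] uM vM.
have q01 : 0 <= q < 1 by rewrite q0; lra.
have M0 : 0 <= M := geometric_majorant_ge0 uM.
rewrite cauchy_product_partial_sum mulr_suml -sumrB.
apply: le_trans (normc_sum _ _ _) _.
apply: (@le_trans _ _ (\sum_(i < N) (2 * M ^+ 2 * q ^+ N))); last first.
  rewrite sumr_const card_ord -[leLHS]mulr_natr -mulrA.
  apply: ler_wpM2l; first by rewrite mulr_ge0 ?exprn_ge0.
  have h1 : q ^+ N <= (1 / 4) ^+ N by apply: lerXn2r; rewrite ?nnegrE//; lra.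
  have h2 : (N%:R : R) <= 2 ^+ N by rewrite -natrX ler_nat ltnW// ltn_expl.
  have -> : (1 / 2 : R) ^+ N = (1 / 4) ^+ N * 2 ^+ N.
    by rewrite -exprMn; congr (_ ^+ N); lra.
  by apply: ler_pM; rewrite ?exprn_ge0.
apply: ler_sum => i _; rewrite -mulrBr normcM.
have iN := ltnW (ltn_ord i).
have -> : \sum_(j < N) v j - \sum_(j < N - i) v j = \sum_(j < i) v (N - i + j)%N.
  by rewrite -sum_ordD_sub subnK.
have := normc_sum_tail_le (N - i) i q01 vM; set s := normc (\sum_(j < i) _) => hs.
have -> : 2 * M ^+ 2 * q ^+ N = (M * q ^+ i) * (2 * (M * q ^+ (N - i))).
  by rewrite -{1}(subnKC iN) exprD; ring.
apply: ler_pM; rewrite ?normc_ge0 ?uM//.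
apply: le_trans hs _; rewrite ler_pdivrMr; last lra.
have : 0 <= M * q ^+ (N - i) by rewrite mulr_ge0 ?exprn_ge0.
nra.
Qed.

Lemma cvg_half_pow (K : R) e : 0 < e -> \forall n \near \oo, K * (1 / 2) ^+ n < e.
Proof.
move=> e0; have h : `|1 / 2 : R| < 1 by rewrite ger0_norm; lra.
have /cvgrPdist_lt /(_ _ e0) := @cvg_geometric _ K _ h.
apply: filterS => n; rewrite sub0r normrN; exact: le_lt_trans (ler_norm _).
Qed.

Lemma analytic_mul (f1 f2 : C -> C) c : analytic_at f1 c -> analytic_at f2 c ->
  analytic_at (fun z => f1 z * f2 z) c.
Proof.
move=> /analytic_has_expansion [a [r1 [M1 H1]]].
move=> /analytic_has_expansion [b [r2 [M2 H2]]].
exists (fun n => \sum_(i < n.+1) a i * b (n - i)%N); apply/nearC_ltP.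
have [r10 _ fa] := H1; have [r20 _ fb] := H2.
pose r := Num.min r1 r2.
have r0 : 0 < r by rewrite /r lt_min r10.
exists (r / 4); first by rewrite divr_gt0.
move=> z zr; pose x := z - c; pose q := normc x / r.
have q0 : 0 <= q by rewrite divr_ge0 ?normc_ge0// ltW.
have q4 : q <= 1 / 4 by rewrite ler_pdivrMr// mulrC mulrA mulr1 ltW.
have rr1 : r <= r1 by rewrite /r ge_min lexx.
have rr2 : r <= r2 by rewrite /r ge_min lexx orbT.
have le_term f' a' r' M' k : has_expansion f' c a' r' M' -> r <= r' ->
    M' <= Num.max M1 M2 -> normc (a' k * x ^+ k) <= Num.max M1 M2 * q ^+ k.
  move=> H rr' MM; apply: le_trans (expansion_term_le z k H) _.
  have [r'0 aM' _] := H.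
  have M'0 : 0 <= M' := expansion_bound_ge0 H.
  apply: ler_pM => //; first by rewrite exprn_ge0// divr_ge0 ?normc_ge0// ltW.
  apply: lerXn2r; rewrite ?nnegrE// ?divr_ge0 ?normc_ge0//; first exact: ltW.
  by apply: ler_wpM2l; rewrite ?normc_ge0// lef_pV2.
have ha k := le_term _ _ _ _ k H1 rr1 ltac:(by rewrite le_max lexx).
have hb k := le_term _ _ _ _ k H2 rr2 ltac:(by rewrite le_max lexx orbT).
have q04 : 0 <= q <= 1 / 4 by rewrite q0.
have zr1 : normc (z - c) < r1 by lra.
have zr2 : normc (z - c) < r2 by lra.
have /cvgC_ltP hAB : (fun n => [series a k * (z - c) ^+ k]_k n *
    [series b k * (z - c) ^+ k]_k n) @ \oo --> f1 z * f2 z.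
  exact: cvgC_M (fa z zr1) (fb z zr2).
apply/cvgC_ltP => e e0; have e2 : 0 < e / 2 by rewrite divr_gt0.
near=> n.
have h1 : normc ([series a k * (z - c) ^+ k]_k n * [series b k * (z - c) ^+ k]_k n
  - f1 z * f2 z) < e / 2 by near: n; exact: hAB.
have h2 : 2 * Num.max M1 M2 ^+ 2 * (1 / 2) ^+ n < e / 2.
  by near: n; exact: cvg_half_pow.
set s := series _ n.
have sE : s =
    \sum_(m < n) \sum_(i < m.+1) (a i * x ^+ i) * (b (m - i)%N * x ^+ (m - i)).
  rewrite /s series_ordE; apply: eq_bigr => m _ /=; rewrite mulr_suml.
  by apply: eq_bigr => i _; rewrite mulrACA -exprD subnKC// -ltnS.
set A := series (fun n => a n * (z - c) ^+ n) n.
set B := series (fun n => b n * (z - c) ^+ n) n.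
have := cauchy_product_error_le n q04 ha hb.
rewrite -sE -(series_ordE (fun k => a k * x ^+ k)).
rewrite -(series_ordE (fun k => b k * x ^+ k)).
rewrite -/A -/B => h3; rewrite -/A -/B in h1.
have -> : s - f1 z * f2 z = - (A * B - s) + (A * B - f1 z * f2 z) by ring.
apply: le_lt_trans (le_normcD _ _) _; rewrite normcN.
lra.
Unshelve. all: by end_near. Qed.

(** Otherwise let [a n] be the first nonzero coefficient: at a zero at
    distance t from [c], the remainder estimate bounds |a n| t^n by a multiple
    of t^(n+1), and t can be taken arbitrarily small. *)
Lemma analytic_accumulating_zeros f c : analytic_at f c ->
  (forall e : R, 0 < e -> exists z, [/\ z != c, normc (z - c) < e & f z = 0]) ->
  \forall z \near c, f z = 0.
Proof.
move=> /analytic_has_expansion [a [r [M H]]] zeros.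
have [r0 aM fa] := H.
suff a0 n : a n = 0.
  apply/nearC_ltP; exists r => // z /fa h.
  apply: (cvgC_unique h).
  rewrite (_ : series _ = fun=> 0); first exact: cvgC_cst.
  by apply/funext => n; rewrite series_ordE big1// => i _; rewrite a0 mul0r.
have M0 : 0 <= M := expansion_bound_ge0 H.
elim/ltn_ind: n => n IH; apply: eq0_normc; apply/eqP.
rewrite eq_le normc_ge0 andbT; apply/ler_addgt0Pl => e e0; rewrite addr0.
pose d := Num.min (r / 2) (e * r ^+ n.+1 / (2 * M + 1)).
have M1 : 0 < 2 * M + 1 by lra.
have rn1 : 0 < r ^+ n.+1 by rewrite exprn_gt0.
have d0 : 0 < d by rewrite /d lt_min !divr_gt0// mulr_gt0.
have [z [zc]] := zeros d d0; rewrite /d lt_min => /andP[zr zM] fz.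
pose x := z - c; pose q := normc x / r.
have x0 : 0 < normc x by rewrite normc_gt0 subr_eq0.
have := @expansion_remainder_le n.+1 _ _ _ _ _ z H _.
rewrite big_ord_recr/= big1 ?add0r; last by move=> i _; rewrite IH ?mul0r.
rewrite fz sub0r normcN -/x -/q => /(_ ltac:(rewrite /x; lra)) h.
move: h; rewrite normcM normcXE /q expr_div_n exprSr.
have xn : 0 < normc x ^+ n by rewrite exprn_gt0.
rewrite [leRHS](_ : _ = (2 * M * normc x / r ^+ n.+1) * normc x ^+ n); last by ring.
rewrite ler_pM2r// => /le_trans; apply.
rewrite ler_pdivrMr//; move: zM; rewrite ltr_pdivlMr// -/x.
nra.
Qed.

(** The zeros propagate along the segment from 0 to [z].  If [h] vanishes on
    this segment up to time T, the last point is an accumulation point of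
    zeros, hence [h] vanishes near it and T can only be maximal if it is 1. *)
Theorem entire_identity (h : C -> C) : entire h ->
  (\forall z \near (0 : C), h z = 0) -> forall z, h z = 0.
Proof.
move=> hE /nearC_ltP [d d0 hd] z.
have [->|z0] := eqVneq z 0; first by apply: hd; rewrite subrr normc0.
have nz0 : 0 < normc z by rewrite normc_gt0.
pose E : set R := [set t | t <= 1 /\ forall s, 0 <= s <= t -> h (s%:C%C * z) = 0].
have nrz (s t : R) : normc (s%:C%C * z - t%:C%C * z) = `|s - t| * normc z.
  by rewrite -mulrBl normcM -rmorphB normc_real.
pose e0 := Num.min 1 (d / 2 / normc z).
have e00 : 0 < e0 by rewrite lt_min ltr01 !divr_gt0.
have Ee0 : E e0.
  split; first by rewrite ge_min lexx.
  move=> s /andP[s0 se]; apply: hd; rewrite subr0 normcM normc_real ger0_norm//.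
  have : s <= d / 2 / normc z by apply: le_trans se _; rewrite ge_min lexx orbT.
  by rewrite ler_pdivlMr//; lra.
have supE : has_sup E by split; [exists e0|exists 1 => t []].
pose T := sup E.
have e0T : e0 <= T by apply: sup_upper_bound.
have below s : 0 <= s < T -> h (s%:C%C * z) = 0.
  move=> /andP[s0 sT]; have Ts : 0 < T - s by rewrite subr_gt0.
  have [t [_ Et] st] := sup_adherent Ts supE.
  by apply: Et; rewrite s0 ltW//; move: st; rewrite -/T; lra.
have /nearC_ltP [r r0 hr] : \forall w \near T%:C%C * z, h w = 0.
  apply: analytic_accumulating_zeros; first exact: hE.
  move=> e epos.
  pose m := Num.min T (e / normc z).
  have m0 : 0 < m by rewrite lt_min (lt_le_trans e00)//= divr_gt0.
  have mT : m <= T by rewrite ge_min lexx.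
  have me : m <= e / normc z by rewrite ge_min lexx orbT.
  exists ((T - m / 2)%:C%C * z).
  have nE : normc ((T - m / 2)%:C%C * z - T%:C%C * z) = m / 2 * normc z.
    by rewrite nrz (_ : _ - T = - (m / 2)) ?normrN ?ger0_norm//; lra.
  split.
  - by rewrite -subr_eq0 -normc_gt0 nE mulr_gt0// divr_gt0.
  - by rewrite nE; move: me; rewrite ler_pdivlMr//; nra.
  - by apply: below; apply/andP; split; lra.
pose e1 := Num.min 1 (T + r / 2 / normc z).
have rz : 0 < r / 2 / normc z by rewrite !divr_gt0.
have Ee1 : E e1.
  split; first by rewrite ge_min lexx.
  move=> s /andP[s0 se]; have [sT|Ts] := ltP s T; first by apply: below; rewrite s0.
  apply: hr; rewrite nrz ger0_norm ?subr_ge0//.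
  have : s <= T + r / 2 / normc z by apply: le_trans se _; rewrite ge_min lexx orbT.
  rewrite addrC -lerBlDr ler_pdivlMr//; lra.
have e1T : e1 <= T by apply: sup_upper_bound.
have e11 : e1 = 1.
  have Tlt : T < T + r / 2 / normc z by rewrite ltrDl.
  by move: e1T; rewrite /e1; case: (leP 1 (T + _)) => // _; rewrite leNgt Tlt.
have [_ /(_ 1)] := Ee1; rewrite e11 lexx ler01 mul1r; exact.
Qed.

End PowerSeries.

(** * The functional equation of the inverse *)

Section FunctionalEquation.
Context {R : realType}.
Local Notation C := R[i].
Local Notation phi := (phi R).

(** That the derivative of [g] at phi is 1, with the error relative to
    [w - phi] so that [w = phi] is included. *)
Lemma g_derivative (e : R) : 0 < e -> exists2 d : R, 0 < d &
  forall w : C, normc (w - phi) < d ->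
    normc (g w - (w - phi)) <= e * normc (w - phi).
Proof.
move=> e0; have /andP[_ i1] := @inv_golden01 R.
pose k : R := 1 - golden^-1; have k0 : 0 < k by rewrite /k; lra.
exists (Num.min (k / 2) (e * k / 2)).
  by rewrite lt_min !divr_gt0// mulr_gt0.
move=> w; rewrite lt_min => /andP[w1 w2]; have [G -> G1] := g_factor w.
have -> : (w - phi) * G - (w - phi) = (w - phi) * (G - 1) by ring.
rewrite normcM mulrC; apply: ler_wpM2r; first exact: normc_ge0.
apply: le_trans G1 _; rewrite -/k; set T := normc (w - phi) / k.
have T0 : 0 <= T by rewrite divr_ge0 ?normc_ge0// ltW.
have T1 : T <= 1 / 2 by rewrite ler_pdivrMr//; lra.
have T2 : T <= e / 2 by rewrite ler_pdivrMr//; lra.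
have := expR_sub1_le T; have := expR_gt0 T; nra.
Qed.

Section Inverse.
Context (f : C -> C) (f_entire : entire f) (f_inv : local_inverse g f phi 0).

(** By Schroeder's equation both sides have the image [u] under [g]; the right
    side is close to phi, where [f] inverts [g]. *)
Lemma inverse_radical_step_near :
  \forall u \near (0 : C), f u = radical_step (f (2 * phi * u)).
Proof.
have [f0 /nearC_ltP [d d0 gf] /nearC_ltP [e e0 fg]] := f_inv.
have [d' d'0 fc] := analytic_continuous (f_entire 0) e0.
have gp := @golden_gt0 R; have gp1 := @golden_gt32 R.
pose m := Num.min d d'; have m0 : 0 < m by rewrite lt_min d0.
apply/nearC_ltP; exists (m / (2 * golden)); first by rewrite divr_gt0// mulr_gt0.
move=> u; rewrite subr0 ltr_pdivlMr ?mulr_gt0// => um.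
have : normc (2 * phi * u) < m by rewrite normcM normc_twophi mulrC.
rewrite /m lt_min => /andP[ud ud'].
have close : normc (radical_step (f (2 * phi * u)) - phi) < e.
  apply: le_lt_trans (normc_radical_step_subphi _) _.
  have h := fc (2 * phi * u); rewrite subr0 f0 in h.
  apply: le_lt_trans (h ud'); rewrite ler_pdivrMr//.
  have := normc_ge0 (f (2 * phi * u) - phi); nra.
rewrite -(fg _ close); congr f; apply: (mulfI twophi_neq0).
by rewrite g_radical_step gf ?subr0.
Qed.

(** Near 0 this is the square of [inverse_radical_step_near], and both sides
    are entire. *)
Lemma functional_equation u : f (2 * phi * u) = f u ^+ 2 - 1.
Proof.
apply/eqP; rewrite -subr_eq0; apply/eqP.
pose h u := f (2 * phi * u) - (f u * f u - 1).
rewrite expr2; apply: (@entire_identity R h) => [c|].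
  apply: analytic_sub; first exact: analytic_scale.
  by apply: analytic_sub; [exact: analytic_mul | exact: analytic_cst].
move: inverse_radical_step_near => /nearC_ltP [e e0 H].
apply/nearC_ltP; exists e => // v /H.
by rewrite /h => ->; rewrite -expr2 radical_step_sqr; ring.
Qed.

Lemma functional_equation_iter n u :
  f ((2 * phi) ^+ n * u) = iter n (fun w => w ^+ 2 - 1) (f u).
Proof.
elim: n => [|n IH]; first by rewrite expr0 mul1r.
by rewrite exprS -mulrA functional_equation IH.
Qed.

(** The derivative of [f] at 0 is 1, in the form needed for the limit of the
    finite products.  The point z / (2 phi)^n is the image under [g] of its
    image under [f], so [g_derivative] compares it with the difference to phi
    up to an arbitrarily small relative error. *)
Lemma inverse_rescaled_cvg z :
  (fun n => (2 * phi) ^+ n * (f (z / (2 * phi) ^+ n) - phi)) @ \oo --> z.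
Proof.
have gp := @golden_gt0 R; have gp1 := @golden_gt32 R.
have [f0 /nearC_ltP [d d0 gf] _] := f_inv.
apply/cvgC_ltP => e e0.
pose nz := normc z; have nz0 : 0 <= nz := normc_ge0 z.
pose k := Num.min (1 / 2) (e / (2 * nz + 1)).
have N1 : 0 < 2 * nz + 1 by lra.
have k0 : 0 < k by rewrite lt_min !divr_gt0.
have k12 : k <= 1 / 2 by rewrite ge_min lexx.
have ke : k * (2 * nz + 1) <= e by rewrite -ler_pdivlMr// ge_min lexx orbT.
have [d1 d10 gd] := g_derivative k0.
have [d2 d20 fc] := analytic_continuous (f_entire 0) d10.
have dd : 0 < Num.min d d2 by rewrite lt_min d0.
have := cvg_half_pow nz dd; apply: filterS => n; rewrite lt_min => /andP[nd nd2].
have L0 : 0 < (2 * golden : R) ^+ n by rewrite exprn_gt0// mulr_gt0.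
pose v := z / (2 * phi) ^+ n.
have nv : normc v <= nz * (1 / 2) ^+ n.
  rewrite /v normcM normcV normcXE normc_twophi; apply: ler_wpM2l => //.
  rewrite -exprVn; apply: lerXn2r; rewrite ?nnegrE ?invr_ge0; [lra | lra |].
  by rewrite mul1r lef_pV2 ?posrE; lra.
have vd : normc (v - 0) < d by rewrite subr0; lra.
have vd2 : normc (v - 0) < d2 by rewrite subr0; lra.
have := gd (f v); rewrite -f0 => /(_ (fc v vd2)); rewrite (gf v vd) f0 => h.
set c := (2 * phi) ^+ n * (f v - phi).
have Ln : normc ((2 * phi) ^+ n) = (2 * golden) ^+ n by rewrite normcXE normc_twophi.
have zc : normc (z - c) <= k * normc c.
  have zE : z = (2 * phi) ^+ n * v by rewrite mulrC divfK// expf_neq0// twophi_neq0.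
  rewrite {1}zE /c -mulrBr.
  rewrite !normcM Ln [leRHS]mulrA (mulrC k) -mulrA.
  by apply: ler_wpM2l h; exact: ltW.
have cz : normc c <= 2 * nz.
  have := le_normcD (c - z) z; rewrite subrK normcB -/nz.
  have := normc_ge0 c; nra.
rewrite normcB; apply: le_lt_trans zc _; have := normc_ge0 c; nra.
Qed.

End Inverse.
End FunctionalEquation.

(** * Nested radicals as iterated preimages *)

Section NestedRadicals.
Context {R : realType}.
Local Notation C := R[i].
Local Notation phi := (phi R).
Implicit Types (s : nat -> C) (n m k j : nat).

(** Starting from y_0 = 1 makes the innermost radical, the square root of 2,
    obey the same recursion as all others. *)
Definition nested_radical s n : C := if n is m.+1 then radical s m else 1.
Arguments nested_radical : simpl never.

Lemma nested_radicalS s n :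
  nested_radical s n.+1 = s n * radical_step (nested_radical s n).
Proof. by case: n. Qed.

Lemma eq_nested_radical s s' n : (forall k, (k < n)%N -> s k = s' k) ->
  nested_radical s n = nested_radical s' n.
Proof.
elim: n => // n IH ss'; rewrite !nested_radicalS ss'// IH// => k kn.
by apply: ss'; rewrite ltnS ltnW.
Qed.

Definition sign_sequence s := forall n, s n = 1 \/ s n = -1.

Section SignSequence.
Context (s : nat -> C) (s_sign : sign_sequence s).
Local Notation y := (nested_radical s).
Local Notation p := (radical_partial_prod s).

Lemma nested_radical_sqr n : y n.+1 ^+ 2 = 1 + y n.
Proof.
rewrite nested_radicalS exprMn radical_step_sqr.
by case: (s_sign n) => ->; rewrite ?sqrrN expr1n mul1r.
Qed.

(** The disk of radius phi contains the preimages of its points under w^2 - 1,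
    because phi^2 = 1 + phi. *)
Lemma normc_nested_radical_le n : normc (y n) <= golden.
Proof.
have g32 := @golden_gt32 R; have gs := @golden_sqr R.
elim: n => [|n IH]; first by rewrite normc1E; lra.
rewrite -(@ler_pXn2r _ 2) ?nnegrE ?normc_ge0//; last lra.
rewrite -normcXE nested_radical_sqr gs; apply: le_trans (le_normcD _ _) _.
by rewrite normc1E lerD2l.
Qed.

Lemma nested_radical_factor n : (phi + y n.+1) * (phi - y n.+1) = phi - y n.
Proof.
have -> : (phi + y n.+1) * (phi - y n.+1) = phi ^+ 2 - y n.+1 ^+ 2 by ring.
by rewrite phi_sqr nested_radical_sqr; ring.
Qed.

Lemma radical_partial_prodS n : p n.+1 = p n * ((phi + y n.+1) / (2 * phi)).
Proof. by rewrite /radical_partial_prod big_ord_recr. Qed.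

(** The product telescopes by [nested_radical_factor], starting from
    phi (phi - y_0) = phi (phi - 1) = 1. *)
Lemma radical_partial_prod_eq1 n :
  p n * ((2 * phi) ^+ n * phi * (phi - y n)) = 1.
Proof.
elim: n => [|n IH].
  rewrite /radical_partial_prod big_ord0 expr0 /= !mul1r mulrBr mulr1 -expr2 phi_sqr.
  by rewrite addrK.
rewrite -[RHS]IH radical_partial_prodS -(nested_radical_factor n) exprSr.
have E (P L f b u v : C) :
  f != 0 -> P * (u / f) * (L * f * b * v) = P * (L * b * (u * v)).
  by move=> f0; field.
exact: E twophi_neq0.
Qed.

Lemma normc_radical_partial_prodS_le n : normc (p n.+1) <= normc (p n).
Proof.
rewrite radical_partial_prodS normcM -[leRHS]mulr1; apply: ler_wpM2l.
  exact: normc_ge0.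
rewrite normcM normcV normc_twophi ler_pdivrMr ?mul1r; last first.
  by rewrite mulr_gt0// golden_gt0.
apply: le_trans (le_normcD _ _) _; rewrite normc_phi.
have := normc_nested_radical_le n.+1; lra.
Qed.

Lemma normc_radical_partial_prod_le n m : (n <= m)%N -> normc (p m) <= normc (p n).
Proof.
move=> /subnKC <-; elim: (m - n)%N => [|k IH]; first by rewrite addn0.
by rewrite addnS; exact: le_trans (normc_radical_partial_prodS_le _) IH.
Qed.

(** A radical with outermost sign -1 has nonpositive real part, hence is at
    distance at least phi from phi; the closed form of the partial product
    then bounds it at this index, and later factors have modulus at most 1. *)
Lemma normc_radical_partial_prod_minus n m : s n = -1 -> (n < m)%N ->
  normc (p m) <= (2 * golden)^-1 ^+ n.+1.
Proof.
move=> sn nm; apply: le_trans (normc_radical_partial_prod_le nm) _.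
have g32 := @golden_gt32 R.
have yE : y n.+1 = - radical_step (y n) by rewrite nested_radicalS sn mulN1r.
have h1 : golden <= normc (phi - y n.+1).
  by rewrite yE opprK; exact: normc_phiD_ge (Re_sqrtc_ge0 _).
have := congr1 (@normc R) (radical_partial_prod_eq1 n.+1).
rewrite !normcM normcXE normc_twophi normc_phi normc1E.
have L0 : 0 < (2 * golden : R) ^+ n.+1 by rewrite exprn_gt0//; lra.
move=> H; rewrite exprVn -[leRHS]mul1r ler_pdivlMr// -[leRHS]H.
apply: ler_wpM2l; first exact: normc_ge0.
have E (x a b : R) : 0 <= x -> 1 <= a * b -> x <= x * a * b by nra.
by apply: E; [exact: ltW | nra].
Qed.

(** Beyond the last sign -1 the radicals are iterates of [radical_step], which
    approach phi geometrically, so the factors approach 1. *)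
Lemma radical_partial_prod_cvg m : (forall k, (m <= k)%N -> s k = 1) ->
  exists l : C, p @ \oo --> l.
Proof.
move=> s1; have g32 := @golden_gt32 R.
have yE n : y (m + n) = iter n radical_step (y m).
  elim: n => [|n IH]; first by rewrite addn0.
  by rewrite addnS nested_radicalS s1 ?leq_addr// mul1r IH.
pose u k := (y (m + k).+1 - phi) / (2 * phi).
have [k|l ul _] := @cvg_prod1D_geometric _ u (normc (y m - phi)) _ inv_golden01.
  rewrite /u -addnS yE normcM normcV normc_twophi ler_pdivrMr; last lra.
  apply: le_trans (normc_iter_radical_step_subphi _ _) _.
  have [i0 i1] := andP (@inv_golden01 R).
  rewrite exprSr mulrA; apply: ler_wpM2l; last lra.
  by rewrite mulr_ge0 ?normc_ge0 ?exprn_ge0.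
have pE n : p (m + n) = p m * \prod_(k < n) (1 + u k).
  elim: n => [|n IH]; first by rewrite addn0 big_ord0 mulr1.
  rewrite addnS radical_partial_prodS IH big_ord_recr/= [RHS]mulrA; congr (_ * _).
  have E (b v : C) : b != 0 -> (b + v) / (2 * b) = 1 + (v - b) / (2 * b).
    by move=> b0; field.
  exact: E phi_neq0.
exists (p m * l); apply: (@cvgC_unshift _ m).
rewrite (_ : (fun n => _) = (fun n => p m * \prod_(k < n) (1 + u k))).
  by apply: cvgC_M ul; exact: cvgC_cst.
by apply/funext => n; exact: pE.
Qed.

End SignSequence.

(** The sequences of signs that are eventually +1 are enumerated by the binary
    digits of natural numbers, a digit 1 standing for the sign -1.  The
    sequences that are +1 from index [n] on correspond to [j < 2 ^ n]. *)
Definition sign_of j : nat -> C := fun k => (-1) ^+ (j %/ 2 ^ k).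

Lemma sign_of_sign j : sign_sequence (sign_of j).
Proof.
move=> k; rewrite /sign_of -signr_odd; case: odd; [right|left] => //.
Qed.

Lemma sign_of_small n j k : (j < 2 ^ n)%N -> (n <= k)%N -> sign_of j k = 1.
Proof.
by move=> jn nk; rewrite /sign_of divn_small// (leq_trans jn)// leq_exp2l.
Qed.

Lemma sign_of_add_lt n j k : (k < n)%N -> sign_of (2 ^ n + j) k = sign_of j k.
Proof.
move=> kn; rewrite /sign_of divnDl ?dvdn_exp2l ?(ltnW kn)//.
rewrite -expnB// ?(ltnW kn)// exprD -[in LHS]signr_odd oddX subn_eq0 leqNgt kn.
by rewrite mul1r.
Qed.

Lemma sign_of_add_eq n j : (j < 2 ^ n)%N -> sign_of (2 ^ n + j) n = -1.
Proof.
by move=> jn; rewrite /sign_of divnDl// divnn expn_gt0/= divn_small.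
Qed.

Lemma sign_of_surj n s : sign_sequence s -> (forall k, (n <= k)%N -> s k = 1) ->
  exists2 j, (j < 2 ^ n)%N & s = sign_of j.
Proof.
elim: n s => [|n IH] s ss s1.
  by exists 0%N => //; apply/funext => k; rewrite s1// (@sign_of_small 0).
have [sn|sn] := ss n.
  have [|j jn ->] := IH s ss.
    by move=> k; rewrite leq_eqVlt => /orP[/eqP <- //|]; exact: s1.
  by exists j => //; rewrite (leq_trans jn)// leq_exp2l.
(* Flipping the sign of index [n] clears the digit of weight 2^n. *)
pose s' k := if k == n then 1 else s k.
have [||j jn s'E] := IH s'.
- by move=> k; rewrite /s'; case: eqP => // _; left.
- move=> k; rewrite leq_eqVlt /s' => /orP[/eqP <-|nk]; first by rewrite eqxx.
  by rewrite gtn_eqF//; exact: s1.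
exists (2 ^ n + j)%N; first by rewrite expnS mul2n -addnn ltn_add2l.
apply/funext => k; have [kn|nk|->] := ltngtP k n.
- by rewrite sign_of_add_lt// -s'E /s' ltn_eqF.
- rewrite s1// (@sign_of_small n.+1)//.
  by rewrite expnS mul2n -addnn ltn_add2l.
- by rewrite sn sign_of_add_eq.
Qed.

Lemma sign_of_inj : injective sign_of.
Proof.
suff H n : forall i j, (i < 2 ^ n)%N -> (j < 2 ^ n)%N ->
    (forall k, odd (i %/ 2 ^ k) = odd (j %/ 2 ^ k)) -> i = j.
  move=> i j ij; apply: (H (maxn i j)) => [||k].
  - by rewrite (leq_trans (ltn_expl i (ltnSn 1)))// leq_exp2l// leq_maxl.
  - by rewrite (leq_trans (ltn_expl j (ltnSn 1)))// leq_exp2l// leq_maxr.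
  have := congr1 (@^~ k) ij; rewrite /sign_of -signr_odd -[RHS]signr_odd.
  by move=> /(@signr_inj C).
elim: n => [|n IH] i j; first by case: i j => [|i] [|j].
move=> il jl ij; have := ij 0%N; rewrite expn0 !divn1 => o.
rewrite -(odd_double_half i) -(odd_double_half j) o; congr (_ + _.*2)%N.
apply: IH => [||k].
- by rewrite ltn_half_double -mul2n -expnS.
- by rewrite ltn_half_double -mul2n -expnS.
by rewrite -!divn2 -!divnMA -!expnS.
Qed.

(** The indices [j] and [2 ^ n + j] differ in the outermost sign only, so their
    radicals are opposite square roots of 1 + y, and the two factors multiply
    to w^2 - 1 - y: the factor of [j] one level below, evaluated at w^2 - 1. *)
Lemma preimage_factorization n (w : C) :
  iter n (fun v => v ^+ 2 - 1) w - 1 =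
  \prod_(j < 2 ^ n) (w - nested_radical (sign_of j) n).
Proof.
elim: n w => [|n IH] w; first by rewrite big_ord1.
have twoE : (2 ^ n.+1 = 2 ^ n + 2 ^ n)%N by rewrite expnS mul2n addnn.
rewrite iterSr IH twoE big_split_ord/= -big_split/=.
apply: eq_bigr => j _; have jn := ltn_ord j.
rewrite !nested_radicalS (sign_of_small jn)// mul1r sign_of_add_eq// mulN1r opprK.
rewrite (@eq_nested_radical (sign_of (2 ^ n + j)) (sign_of j)); last first.
  by move=> k; exact: sign_of_add_lt.
have -> (v : C) :
    (w - radical_step v) * (w + radical_step v) = w ^+ 2 - radical_step v ^+ 2.
  by ring.
by rewrite radical_step_sqr; ring.
Qed.

End NestedRadicals.

(** * Domination by a summable weight *)

Section DominatedProducts.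
Context {R : realType}.
Local Notation C := R[i].
Local Notation phi := (phi R).

(** [up_log 2 j.+1] is the number of binary digits of [j], that is the position,
    counted from 1, of the last sign -1 of [sign_of j]. *)
Definition weight (j : nat) : R := (2 * golden)^-1 ^+ up_log 2 j.+1.

Lemma inv_twogolden_bounds :
  0 < (2 * golden : R)^-1 < 1 /\ (2 * golden : R)^-1 <= 1 - golden^-1.
Proof.
have g32 := @golden_gt32 R; have gi := @inv_golden01 R.
have g0 : golden != 0 :> R by rewrite gt_eqF ?golden_gt0.
have gE : (2 * golden : R)^-1 = golden^-1 / 2 by rewrite invfM mulrC.
have h : golden * golden^-1 = 1 :> R by rewrite divff.
rewrite gE; split.
  by apply/andP; split; [rewrite divr_gt0 ?invr_gt0 ?golden_gt0|lra].
 move: h gi; set i := golden^-1; nra.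
Qed.

Lemma weight_ge0 j : 0 <= weight j.
Proof. by have [/andP[i0 _] _] := inv_twogolden_bounds; rewrite exprn_ge0 ?ltW. Qed.

Lemma up_log2_block k j :
  (2 ^ k <= j)%N -> (j < 2 ^ k.+1)%N -> up_log 2 j.+1 = k.+1.
Proof.
move=> kj jk; apply/eqP; rewrite eqn_leq up_log_min//= ltnNge; apply/negP => h.
have := up_logP j.+1 (ltnSn 1); rewrite leqNgt ltnS (leq_trans _ kj)//.
by rewrite leq_exp2l.
Qed.

Lemma normc_radical_partial_prod_weight j n : (j < 2 ^ n)%N ->
  normc (radical_partial_prod (sign_of j) n) <= weight j.
Proof.
move=> jn; rewrite /weight; have mn : (up_log 2 j.+1 <= n)%N by exact: up_log_min.
have := @up_log_gtn 2 j.+1; case E : (up_log 2 j.+1) mn => [|k] mn.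
  move=> _; rewrite expr0 -(@normc1E R).
  rewrite -[leRHS](_ : normc (radical_partial_prod (sign_of j) 0) = _).
    exact: normc_radical_partial_prod_le (sign_of_sign j) _ _ mn.
  by rewrite /radical_partial_prod big_ord0.
move=> /(_ isT) H.
apply: normc_radical_partial_prod_minus => //; first exact: sign_of_sign.
have kj : (2 ^ k <= j)%N.
  have [j0|j0] := posnP j; first by move: E; rewrite j0 up_log1.
  by rewrite -ltnS; exact: H.
have jk : (j < 2 ^ k.+1)%N by rewrite -E up_logP.
rewrite -(subnKC kj) sign_of_add_eq//.
by rewrite -(ltn_add2l (2 ^ k)) subnKC// addnn -mul2n -expnS.
Qed.

(** The 2^k numbers with k + 1 digits contribute
    2^k (2 phi)^-(k+1) = phi^-k / (2 phi) together, at most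
    phi^-k - phi^-(k+1), and these differences telescope. *)
Lemma weight_block_sum N n : (N <= n)%N ->
  \sum_(2 ^ N <= j < 2 ^ n) weight j <= golden^-1 ^+ N - golden^-1 ^+ n.
Proof.
have [/andP[i0 i1] i2] := inv_twogolden_bounds.
have [g0 g1] := andP (@inv_golden01 R).
move=> /subnKC <-; elim: (n - N)%N => [|m IH]; first by rewrite addn0 big_geq// subrr.
rewrite addnS; set k := (N + m)%N in IH *.
rewrite (@big_cat_nat _ _ _ (2 ^ k)%N)/= ?leq_exp2l ?leq_addr//.
have block : \sum_(2 ^ k <= j < 2 ^ k.+1) weight j = golden^-1 ^+ k * (2 * golden)^-1.
  rewrite (eq_big_nat _ _ (F2 := fun=> (2 * golden)^-1 ^+ k.+1)); last first.
    by move=> j /andP[kj jk]; rewrite /weight (up_log2_block kj jk).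
  rewrite sumr_const_nat expnS mul2n -addnn addnK -[LHS]mulr_natr natrX exprSr.
  rewrite mulrAC -exprMn; congr (_ ^+ _ * _).
  by rewrite invfM mulrC mulrA divff ?mul1r.
rewrite block; apply: le_trans (lerD IH (lexx _)) _.
rewrite (exprS _ k); have : 0 <= golden^-1 ^+ k :> R by rewrite exprn_ge0.
move: i2; set a := golden^-1 ^+ k; set b := golden^-1; set c := (2 * golden)^-1; nra.
Qed.

Lemma weight_tail_sum N (l : seq nat) : uniq l -> {in l, forall j, (2 ^ N <= j)%N} ->
  \sum_(j <- l) weight j <= golden^-1 ^+ N.
Proof.
move=> ul lN; pose n := (N + \max_(j <- l) j)%N.
have ln j : j \in l -> (j < 2 ^ n)%N.
  move=> jl; rewrite (leq_trans (ltn_expl j (ltnSn 1)))// leq_exp2l//.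
  by rewrite (leq_trans _ (leq_addl _ _))// (@leq_bigmax_seq _ l xpredT id j).
have lE : perm_eq l [seq j <- index_iota (2 ^ N) (2 ^ n) | j \in l].
  apply: uniq_perm => //; first by rewrite filter_uniq// iota_uniq.
  move=> j; rewrite mem_filter mem_index_iota; case jl: (j \in l) => //=.
  by rewrite lN//= ln.
rewrite (perm_big _ lE) big_filter/= big_mkcond/=.
apply: le_trans (_ : \sum_(2 ^ N <= j < 2 ^ n) weight j <= _).
  by apply: ler_sum => j _; case: ifP => // _; exact: weight_ge0.
apply: le_trans (weight_block_sum (leq_addr _ _)) _.
by rewrite gerBl exprn_ge0//; have /andP[] := @inv_golden01 R.
Qed.

Lemma weight_sum_le2 (l : seq nat) : uniq l -> \sum_(j <- l) weight j <= 2.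
Proof.
move=> ul; have [l0|l0] := boolP (0%N \in l).
  rewrite (perm_big _ (perm_to_rem l0)) big_cons/= {1}/weight up_log1 expr0.
  have := @weight_tail_sum 0 (rem 0%N l) (rem_uniq _ ul); rewrite expr0 => h.
  rewrite -[leRHS](_ : 1 + 1 = _)// lerD2l; apply: h => j.
  by rewrite mem_rem_uniq// inE expn0 lt0n => /andP[].
have := @weight_tail_sum 0 l ul; rewrite expr0 => h.
apply: le_trans (h _) _; last lra.
by move=> j jl; rewrite expn0 lt0n; apply: contraNneq l0 => <-.
Qed.

(** The constants come from [dominated_product_le]: [exp (2 K)] bounds the first
    factors, whose weights add up to at most 2, and
    [K phi^-N exp K] bounds the deviation from 1 of the product of the others. *)
Definition tail_error (K : R) (N : nat) : R :=
  K * expR (3 * K) * golden^-1 ^+ N.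

(** The estimate depends neither on the number of factors nor on [x], only on
    the domination; it serves both for the finite product formulas and for the
    products over finite subsets of [Sigma]. *)
Lemma dominated_product_le (x : nat -> C) (K : R) N (l : seq nat) : 0 <= K ->
  (forall j, normc (x j) <= K * weight j) -> uniq l ->
  (forall j, (j < 2 ^ N)%N -> j \in l) ->
  normc (\prod_(j <- l) (1 + x j) - \prod_(j < 2 ^ N) (1 + x j)) <= tail_error K N.
Proof.
move=> K0 xK ul lN.
have lE : perm_eq l (iota 0 (2 ^ N) ++ [seq j <- l | (2 ^ N <= j)%N]).
  apply: uniq_perm => //.
    rewrite cat_uniq iota_uniq filter_uniq//= andbT; apply/hasPn => j.
    by rewrite mem_filter mem_iota add0n/= => /andP[+ _]; rewrite -leqNgt.
  move=> j; rewrite mem_cat mem_iota mem_filter add0n/=.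
  by case: (ltnP j (2 ^ N)) => //= jN; rewrite lN.
rewrite (perm_big _ lE) big_cat/=.
have -> : \prod_(j < 2 ^ N) (1 + x j) = \prod_(j <- iota 0 (2 ^ N)) (1 + x j).
  by rewrite -(big_mkord xpredT (fun j => 1 + x j)) /index_iota subn0.
set A := \prod_(j <- iota _ _) _; set B := \prod_(j <- [seq _ <- _ | _]) _.
have -> : A * B - A = A * (B - 1) by ring.
have gi := andP (@inv_golden01 R); have gN : 0 <= (golden : R)^-1 ^+ N <= 1.
  by rewrite exprn_ge0 ?exprn_ile1//; lra.
have hA : normc A <= expR (2 * K).
  apply: normc_prod1D_le xK _; rewrite -mulr_sumr mulrC.
  by apply: ler_wpM2r => //; apply: weight_sum_le2; exact: iota_uniq.
have hB : normc (B - 1) <= K * golden^-1 ^+ N * expR K.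
  apply: le_trans (_ : K * golden^-1 ^+ N * expR (K * golden^-1 ^+ N) <= _).
    apply: normc_prod1D_sub1_le xK _; rewrite -mulr_sumr; apply: ler_wpM2l => //.
    apply: weight_tail_sum; first exact: filter_uniq.
    by move=> j; rewrite mem_filter => /andP[].
  have [g0 g1] := andP gN; apply: ler_wpM2l; first by rewrite mulr_ge0.
  by rewrite ler_expR; nra.
rewrite normcM /tail_error.
have -> : K * expR (3 * K) * golden^-1 ^+ N =
    expR (2 * K) * (K * golden^-1 ^+ N * expR K).
  by rewrite (_ : 3 * K = 2 * K + K) ?expRD; ring.
by apply: ler_pM => //; exact: normc_ge0.
Qed.

Lemma tail_error_small (K e : R) : 0 <= K -> 0 < e -> exists N, tail_error K N < e.
Proof.
move=> K0 e0; have gi := @inv_golden01 R.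
have h : `|golden^-1 : R| < 1 by case/andP: gi => g0 g1; rewrite ger0_norm.
have /cvgrPdist_lt /(_ _ e0) [N _ /(_ N (leqnn _))] :=
  @cvg_geometric _ (K * expR (3 * K)) _ h.
rewrite sub0r normrN => hN; exists N; exact: le_lt_trans (ler_norm _) hN.
Qed.

End DominatedProducts.

(** * The product formula *)

#[local] Existing Instance totally_filter.

Section ProductFormula.
Context {R : realType}.
Local Notation C := R[i].
Local Notation phi := (phi R).

Lemma Sigma_sign_of (s : nat -> C) : Sigma R s -> exists j, s = sign_of j.
Proof.
move=> [ss /cvgC_ltP /(_ 1 ltr01) [N _ sN]].
have [|j _ sj] := @sign_of_surj R N s ss; last by exists j.
move=> k Nk; have [//|sk] := ss k; have := sN k Nk; rewrite /= sk.
(* The sign -1 is at distance 2 from the limit. *)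
have -> : -1 - 1 = - (1 + 1)%:C%C :> C by rewrite rmorphD rmorph1; ring.
by rewrite normcN normc_real ger0_norm ?addr_ge0// gtrDl ltNge ler01.
Qed.

Lemma sign_of_Sigma j : Sigma R (sign_of j).
Proof.
split; first exact: sign_of_sign.
apply/cvgC_ltP => e e0; exists j; first by [].
move=> n jn; rewrite /mkset (@sign_of_small _ j _ _ (ltn_expl j (ltnSn 1)) jn).
by rewrite subrr normc0.
Qed.

Lemma radical_prod_cvg (s : nat -> C) : Sigma R s ->
  radical_partial_prod s @ \oo --> radical_prod s.
Proof.
move=> /Sigma_sign_of [j ->].
have [|l hl] := @radical_partial_prod_cvg R (sign_of j) j.
  by move=> k jk; apply: (@sign_of_small _ j) => //; exact: ltn_expl.
by rewrite /radical_prod (cvgC_lim hl).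
Qed.

Lemma normc_radical_prod_weight j : normc (radical_prod (@sign_of R j)) <= weight j.
Proof.
have h := radical_prod_cvg (sign_of_Sigma j).
have := @cvgC_le _ _ \oo _ _ _ 0 (weight j) h; rewrite subr0; apply.
exists j => // n /= jn; rewrite subr0; apply: normc_radical_partial_prod_weight.
by rewrite (leq_trans (ltn_expl j (ltnSn 1)))// leq_exp2l.
Qed.

(** Through a bijection with the natural numbers, a limit over finite subsets
    becomes one over duplicate-free lists containing long initial segments. *)
Lemma totally_enum (I : choiceType) (code : I -> nat) (dec : nat -> I) (M : nat) :
  cancel code dec -> cancel dec code ->
  \forall A \near @totally I, uniq (map code (enum_fset A)) /\
    forall j, (j < M)%N -> j \in map code (enum_fset A).
Proof.
move=> cK dK; exists [fset dec j | j in iota 0 M]%fset => // A /= subA.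
split; first by rewrite map_inj_uniq ?fset_uniq//; exact: can_inj cK.
move=> j jM; rewrite -(dK j); apply: map_f.
by apply: (fsubsetP subA); apply: in_imfset; rewrite /= mem_iota.
Qed.

Lemma Sigma_bijection : exists (code : Sigma R -> nat) (dec : nat -> Sigma R),
  [/\ cancel code dec, cancel dec code & forall s, val s = sign_of (code s)].
Proof.
have H (s : Sigma R) : exists j, val s = sign_of j.
  by apply: Sigma_sign_of; exact: set_mem (valP s).
have [code codeE] := choice H.
pose dec j : Sigma R := SigSub (mem_set (sign_of_Sigma j)).
have dK : cancel dec code by move=> j; apply: (@sign_of_inj R); rewrite -codeE.
exists code, dec; split => // s; apply: val_inj; by rewrite /= -codeE.
Qed.

Section Inverse.
Context (f : C -> C) (f_entire : entire f) (f_inv : local_inverse g f phi 0).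

Definition rescaled (z : C) n : C := (2 * phi) ^+ n * (f (z / (2 * phi) ^+ n) - phi).

(** The factorization of the iterate of w^2 - 1, at f (z / (2 phi)^n), divided
    by the same factorization at the fixed point phi. *)
Lemma finite_product_formula z n : phi * (f z - 1) =
  \prod_(j < 2 ^ n) (1 + rescaled z n * phi * radical_partial_prod (sign_of j) n).
Proof.
set L := (2 * phi) ^+ n; have L0 : L != 0 by rewrite expf_neq0// twophi_neq0.
have fz : f z - 1 = \prod_(j < 2 ^ n) (f (z / L) - nested_radical (sign_of j) n).
  by rewrite -preimage_factorization -functional_equation_iter// mulrC divfK.
have phi1 : phi * (phi - 1) = 1 by rewrite mulrBr mulr1 -expr2 phi_sqr addrK.
have fixed : \prod_(j < 2 ^ n) (phi - nested_radical (sign_of j) n) = phi - 1.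
  rewrite -preimage_factorization; congr (_ - _); elim: n {L L0 fz} => // n IH.
  by rewrite iterS IH phi_sqr addrC addKr.
have factor j : f (z / L) - nested_radical (sign_of j) n =
    (1 + rescaled z n * phi * radical_partial_prod (sign_of j) n) *
    (phi - nested_radical (sign_of j) n).
  have := radical_partial_prod_eq1 (sign_of_sign j) n.
  rewrite /rescaled -/L; set p := radical_partial_prod _ _.
  set v := phi - nested_radical _ _ => E.
  have -> : (1 + L * (f (z / L) - phi) * phi * p) * v =
            v + (f (z / L) - phi) * (p * (L * phi * v)) by ring.
  by rewrite E /v mulr1; ring.
rewrite fz; under eq_bigr do rewrite factor.
rewrite big_split/= fixed.
by rewrite mulrCA phi1 mulr1.
Qed.

(** A bound for [rescaled z n * phi] once [rescaled z n] is within 1 of its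
    limit [z]. *)
Definition domination (z : C) : R := golden * (normc z + 1).

Lemma domination_ge0 z : 0 <= domination z.
Proof. by rewrite mulr_ge0// ?addr_ge0 ?normc_ge0// ltW// golden_gt0. Qed.

(** At a level [n >= N], the finite product formula and the product of its
    first 2^N factors differ by at most the tail error.  As [n] tends to
    infinity with [N] fixed, those factors converge one by one. *)
Lemma infinite_product_error z N :
  normc (\prod_(j < 2 ^ N) (1 + z * phi * radical_prod (sign_of j))
         - phi * (f z - 1)) <= tail_error (domination z) N.
Proof.
have rz : rescaled z @ \oo --> z by exact: inverse_rescaled_cvg.
have uP : (fun n => \prod_(j < 2 ^ N)
    (1 + rescaled z n * phi * radical_partial_prod (sign_of j) n)) @ \oo -->
    \prod_(j < 2 ^ N) (1 + z * phi * radical_prod (sign_of j)).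
  apply: (@cvgC_prod _ _ \oo _ _
    (fun j n => 1 + rescaled z n * phi * radical_partial_prod (sign_of j) n)
    (fun j => 1 + z * phi * radical_prod (sign_of j))) => j _.
  apply: cvgC_D; first exact: cvgC_cst.
  apply: cvgC_M; last by apply: radical_prod_cvg; exact: sign_of_Sigma.
  by apply: cvgC_M; [exact: rz | exact: cvgC_cst].
apply: (cvgC_le uP).
have /cvgC_ltP /(_ 1 ltr01) [n0 _ rz1] := rz.
exists (maxn n0 N) => // n /=; rewrite geq_max => /andP[n0n Nn].
have bound : normc (rescaled z n) <= normc z + 1.
  have := le_normcD (rescaled z n - z) z; rewrite subrK.
  by have := rz1 n n0n; rewrite /= -/(rescaled z n); lra.
pose t j := rescaled z n * phi * radical_partial_prod (sign_of j) n.
(* The partial product of length [n] is bounded by the weight of [j] only when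
   [n] reaches the last sign -1, which [j < 2 ^ n] guarantees. *)
pose x j := if (j < 2 ^ n)%N then t j else 0.
have xK j : normc (x j) <= domination z * weight j.
  rewrite /x; case: ifP => jn; last first.
    by rewrite normc0 mulr_ge0 ?domination_ge0 ?weight_ge0.
  rewrite /t normcM [normc (_ * phi)]normcM normc_phi.
  apply: ler_pM; rewrite ?normc_ge0//.
  - exact: mulr_ge0 (normc_ge0 _) golden_ge0.
  - by rewrite mulrC; exact: ler_wpM2l golden_ge0 _ _ bound.
  - exact: normc_radical_partial_prod_weight.
have := @dominated_product_le R x _ N (iota 0 (2 ^ n)) (domination_ge0 z) xK
  (iota_uniq _ _).
have mem j : (j < 2 ^ N)%N -> j \in iota 0 (2 ^ n).
  by rewrite mem_iota add0n/= => /leq_trans; apply; rewrite leq_exp2l.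
move=> /(_ mem).
have -> : \prod_(j <- iota 0 (2 ^ n)) (1 + x j) = phi * (f z - 1).
  rewrite (finite_product_formula z n) -[iota _ _](_ : index_iota 0 (2 ^ n) = _).
    by rewrite big_mkord; apply: eq_bigr => j _; rewrite /x ltn_ord.
  by rewrite /index_iota subn0.
rewrite normcB.
rewrite (eq_bigr (fun j : 'I_(2 ^ N) => 1 + t j)) // => j _.
by rewrite /x (leq_trans (ltn_ord j))// leq_exp2l.
Qed.

(** The product over any finite subset containing the first 2^N sequences and
    the value phi (f z - 1) are both within the tail error of the product over
    these 2^N sequences. *)
Lemma Sigma_partial_prod_cvg z :
  Sigma_partial_prod z @ totally --> phi * (f z - 1).
Proof.
apply/cvgC_ltP => e e0.
have K0 := domination_ge0 z.
have e2 : 0 < e / 2 by rewrite divr_gt0.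
have [N hN] := tail_error_small K0 e2.
have [code [dec [cK dK codeE]]] := Sigma_bijection.
apply: filterS (totally_enum (2 ^ N) cK dK) => A [uA lA].
pose x j := z * phi * radical_prod (@sign_of R j).
have AE : Sigma_partial_prod z A = \prod_(j <- map code (enum_fset A)) (1 + x j).
  by rewrite /Sigma_partial_prod big_map; apply: eq_bigr => s _; rewrite codeE.
have xK j : normc (x j) <= domination z * weight j.
  rewrite /x !normcM normc_phi; apply: ler_pM; rewrite ?normc_ge0//.
  - exact: mulr_ge0 (normc_ge0 _) golden_ge0.
  - by rewrite mulrC; apply: ler_wpM2l golden_ge0 _ _ _; rewrite lerDl.
  - exact: normc_radical_prod_weight.
have h1 := dominated_product_le K0 xK uA lA.
have h2 := infinite_product_error z N.
rewrite AE; set P := \prod_(j < 2 ^ N) (1 + x j) in h1.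
rewrite -/(x _) in h2.
rewrite -[X in normc (X - _)](subrK P) -addrA.
apply: le_lt_trans (le_normcD _ _) _.
have {}h2 : normc (P - phi * (f z - 1)) <= tail_error (domination z) N by exact: h2.
lra.
Qed.

End Inverse.
End ProductFormula.

Theorem theorem4p1 (R : realType) (f : R[i] -> R[i])
    (f_entire : entire f)
    (f_inv : local_inverse g f (phi R) 0) :
  (forall s, Sigma R s -> cvgn (radical_partial_prod s)) /\
  (forall z : R[i],
     cvg (Sigma_partial_prod z @ totally) /\
     f z = 1 + (phi R)^-1 * lim (Sigma_partial_prod z @ totally)).
Proof.
split=> [s sS|z].
  by apply/cvg_ex; exists (radical_prod s); exact: radical_prod_cvg.
have Pz : Sigma_partial_prod z @ totally --> phi R * (f z - 1).
  exact: Sigma_partial_prod_cvg.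
split; first by apply/cvg_ex; exists (phi R * (f z - 1)); exact: Pz.
by rewrite (cvgC_lim Pz) mulKf ?phi_neq0// addrC subrK.
Qed.
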